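(* The bisection fan of the cross-polytope $P=\operatorname{conv}\{\pm e_i:i\in[d]\}\subset\mathbb{R}^d$ is the polyhedral fan induced by the hyperplane arrangement $$\mathcal{H}=\left\{\{x\in\mathbb{R}^d: x_i=0\}\right\}_{i=1}^d\ \cup\ \left\{\{x\in\mathbb{R}^d: x(I)=x(I^c)\}\right\}_{I\subseteq[d]}.$$
   Context: $[d]=\{1,\dots,d\}$, $I^c=[d]\setminus I$, and $x(I)=\sum_{i\in I}x_i$. The norm with unit ball $P$ is the $\ell_1$-norm; the bisector is $\operatorname{bis}(a,b)=\{x\in\mathbb{R}^d:\|x-a\|_1=\|x-b\|_1\}$. For a facet $F$ of $P$, $C_F=\operatorname{cone}(F)$; the facets are $F_I=\operatorname{conv}(\{e_i:i\in I\}\cup\{-e_i:i\in I^c\})$, $I\subseteq[d]$. For facets $F,G$, $\operatorname{bis}_{F,G}(a,b)=\operatorname{bis}(a,b)\cap(C_F+a)\cap(C_G+b)$. Two bisectors $\operatorname{bis}(a,b)$ and $\operatorname{bis}(a',b')$ are equivalent if for all facets $F,G$ of $P$: $\operatorname{bis}_{F,G}(a,b)\ne\emptyset \Leftrightarrow \operatorname{bis}_{F,G}(a',b')\neq\emptyset$. A point $c\in\mathbb{R}^d$ is in general position if there is a neighborhood $U$ of $c$ such that $\operatorname{bis}(0,c)$ is equivalent to $\operatorname{bis}(0,c')$ for all $c'\in U$. A polyhedral fan $\Delta$ is the bisection fan of $P$ if for all $a,b\in\mathbb{R}^d$ in general position the following are equivalent: (i) $\operatorname{bis}(0,a)$ and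 $\operatorname{bis}(0,b)$ are equivalent; (ii) $a$ and $b$ lie in the interior of the same maximal cone of $\Delta$. *)

(* Defs.v *)
From mathcomp Require Import all_boot all_order all_algebra.
From mathcomp Require Import all_classical all_reals topology normedtype.

Set Implicit Arguments.
Unset Strict Implicit.
Unset Printing Implicit Defensive.

Import Order.TTheory GRing.Theory Num.Theory.
Import numFieldNormedType.Exports.

Local Open Scope classical_set_scope.
Local Open Scope ring_scope.

Section Polyhedral.
Context {R : realType} {d : nat}.
Implicit Types (A C F : set 'rV[R]_d) (u v x y : 'rV[R]_d).

Definition dot u x : R := \sum_(i < d) u ord0 i * x ord0 i.

Definition convex_hull A : set 'rV[R]_d :=
  [set x | exists (n : nat) (l : 'I_n -> R) (p : 'I_n -> 'rV[R]_d),
    [/\ forall k, 0 <= l k, \sum_(k < n) l k = 1, forall k, A (p k)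
      & x = \sum_(k < n) l k *: p k]].

Definition conic_hull A : set 'rV[R]_d :=
  [set x | exists (n : nat) (l : 'I_n -> R) (p : 'I_n -> 'rV[R]_d),
    [/\ forall k, 0 <= l k, forall k, A (p k)
      & x = \sum_(k < n) l k *: p k]].

Definition translate A v : set 'rV[R]_d := [set x + v | x in A].

Definition polyhedral_cone C : Prop :=
  exists s : seq 'rV[R]_d, C = [set x | forall v, v \in s -> 0 <= dot v x].

(* The supporting vector [u] may be [0], so a cone is a face of itself. *)
Definition cone_face C F : Prop :=
  exists2 u, (forall x, C x -> 0 <= dot u x) & F = C `&` [set x | dot u x = 0].

Definition polyhedral_fan (Delta : set (set 'rV[R]_d)) : Prop :=
  [/\ finite_set Delta, Delta !=set0,
      forall C, Delta C -> polyhedral_cone C,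
      forall C F, Delta C -> cone_face C F -> Delta F
    & forall C C', Delta C -> Delta C' ->
        cone_face C (C `&` C') /\ cone_face C' (C `&` C')].

Definition maximal_cone (Delta : set (set 'rV[R]_d)) C : Prop :=
  Delta C /\ forall C', Delta C' -> C `<=` C' -> C' = C.

(* The points with the same sign vector as [x]. A linear hyperplane of [H]   *)
(* is tested through all its normal vectors [v]; since these are nonzero     *)
(* multiples of each other, all of them give the same condition.             *)
Definition arrangement_cell (H : set (set 'rV[R]_d)) x : set 'rV[R]_d :=
  [set y | forall v, H [set z | dot v z = 0] ->
     Num.sg (dot v y) = Num.sg (dot v x)].

Definition arrangement_fan (H : set (set 'rV[R]_d)) : set (set 'rV[R]_d) :=
  [set closure (arrangement_cell H x) | x in [set: 'rV[R]_d]].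

End Polyhedral.

Section CrossPolytope.
Context {R : realType} {d : nat}.
Implicit Types (F G : set 'rV[R]_d) (a b c x : 'rV[R]_d) (I : {set 'I_d}).

Definition unit_vec (i : 'I_d) : 'rV[R]_d := delta_mx ord0 i.

(* The facets of the cross-polytope conv {e_i, - e_i}, which is the unit     *)
(* ball of [l1norm].                                                         *)
Definition cross_facet I : set 'rV[R]_d :=
  convex_hull ([set unit_vec i | i in [set i | i \in I]] `|`
               [set - unit_vec i | i in [set i | i \in ~: I]]).

Definition is_facet F : Prop := exists I, F = cross_facet I.

Definition l1norm x : R := \sum_(i < d) `|x ord0 i|.

Definition bis a b : set 'rV[R]_d := [set x | l1norm (x - a) = l1norm (x - b)].

Definition bis_facets F G a b : set 'rV[R]_d :=
  bis a b `&` translate (conic_hull F) a `&` translate (conic_hull G) b.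

Definition bis_equiv a b a' b' : Prop :=
  forall F G, is_facet F -> is_facet G ->
    (bis_facets F G a b !=set0 <-> bis_facets F G a' b' !=set0).

Definition general_position c : Prop :=
  \forall c' \near c, bis_equiv 0 c 0 c'.

Definition is_bisection_fan (Delta : set (set 'rV[R]_d)) : Prop :=
  polyhedral_fan Delta /\
  forall a b, general_position a -> general_position b ->
    (bis_equiv 0 a 0 b <->
     exists C, [/\ maximal_cone Delta C, interior C a & interior C b]).

Definition coord_sum x I : R := \sum_(i in I) x ord0 i.

End CrossPolytope.

Definition cross_arrangement (R : realType) (d : nat) : set (set 'rV[R]_d) :=
  [set [set x : 'rV[R]_d | x ord0 i = 0] | i in [set: 'I_d]] `|`
  [set [set x : 'rV[R]_d | coord_sum x I = coord_sum x (~: I)]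
    | I in [set: {set 'I_d}]].

Arguments cross_arrangement : clear implicits.

(* Main.v *)
(* Write s_I for the vector with entry 1 on I and -1 off I. For x in C_F + 0  *)
(* and in C_G + c, with F = F_I and G = F_J, the difference                   *)
(* |x_i| - |x_i - c_i| ranges exactly over [s_J(i) c_i, s_I(i) c_i], so       *)
(* bis_{F,G}(0, c) is nonempty iff these intervals are nonempty and           *)
(* <s_J, c> <= 0 <= <s_I, c>. Since <s_I, c> = c(I) - c(I^c), this depends    *)
(* only on the sign vector of c. Conversely, if P = {i | 0 <= c_i}, the pair  *)
(* (P, P^c) detects the signs of the coordinates of c and the pairs (I, P^c)  *)
(* detect the signs of the <s_I, c>; hence a point in general position lies   *)
(* on no hyperplane, and equivalence of bisectors is equality of sign vectors.*)
(* Equality of sign vectors amounts to a common maximal cone, because the     *)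
(* closed cells of any central arrangement form a fan: a face of a cell is    *)
(* the closed cell of its point with the most positive forms, and two cells   *)
(* meet in the face cut out by the sum of the normals separating them.        *)
Require Import Defs.
From mathcomp Require Import all_boot all_order all_algebra.
From mathcomp Require Import all_classical all_reals topology normedtype.
From mathcomp Require Import ring lra.

Set Implicit Arguments.
Unset Strict Implicit.
Unset Printing Implicit Defensive.

Import Order.TTheory GRing.Theory Num.Theory.
Import numFieldNormedType.Exports.

Local Open Scope classical_set_scope.
Local Open Scope ring_scope.

(** Both conditions reduce to equality of signs on the finite symmetric family [cross_normals]. On
    the fan side, the closed cells are the cones [sign_cone]; they form a fan
    ([sign_fan_polyhedral]), and generic points share a maximal cone exactly when their signs agree
    ([generic_same_maximal_cone]). On the bisector side, [bis_facets_feasible] turns nonemptiness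
    into weak sign conditions, and suitable facet pairs recover every sign ([bis_equiv_sign_cell]).
    Points in general position are generic because a small move off a hyperplane destroys a feasible
    pair. *)

Section Dot.
Context {R : realType} {d : nat}.
Implicit Types (u v w x y : 'rV[R]_d).

(** * The scalar product *)

Lemma dotC u v : dot u v = dot v u.
Proof. by apply: eq_bigr => i _; rewrite mulrC. Qed.

Lemma dotDr u x y : dot u (x + y) = dot u x + dot u y.
Proof. by rewrite -big_split; apply: eq_bigr => i _; rewrite mxE mulrDr. Qed.

Lemma dotZr u a x : dot u (a *: x) = a * dot u x.
Proof. by rewrite mulr_sumr; apply: eq_bigr => i _; rewrite mxE mulrCA. Qed.

Lemma dotNr u x : dot u (- x) = - dot u x.
Proof. by rewrite -scaleN1r dotZr mulN1r. Qed.

Lemma dotBr u x y : dot u (x - y) = dot u x - dot u y.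
Proof. by rewrite dotDr dotNr. Qed.

Lemma dot0r u : dot u 0 = 0.
Proof. by rewrite -(scale0r 0) dotZr mul0r. Qed.

Lemma dotNl u x : dot (- u) x = - dot u x.
Proof. by rewrite dotC dotNr dotC. Qed.

Lemma dotZl u a x : dot (a *: u) x = a * dot u x.
Proof. by rewrite dotC dotZr dotC. Qed.

Lemma dot0l u : dot 0 u = 0.
Proof. by rewrite dotC dot0r. Qed.

Lemma dot_suml (s : seq 'rV[R]_d) x :
  dot (\sum_(v <- s) v) x = \sum_(v <- s) dot v x.
Proof.
elim: s => [|v s IHs]; first by rewrite !big_nil dot0l.
by rewrite !big_cons dotC dotDr !(dotC x) IHs.
Qed.

Lemma dotvv_eq0 v : (dot v v == 0) = (v == 0).
Proof.
rewrite psumr_eq0 => [|i _]; last by rewrite -expr2 sqr_ge0.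
apply/idP/eqP => [/allP v0|->]; last by apply/allP => i _; rewrite /= mxE mul0r.
apply/rowP => i; have := v0 i; rewrite mem_index_enum mulf_eq0 orbb mxE.
by move=> /(_ isT)/eqP.
Qed.

Lemma dotvv_ge0 v : 0 <= dot v v.
Proof. by apply: sumr_ge0 => i _; rewrite -expr2 sqr_ge0. Qed.

(** The component [w'] of [w] orthogonal to [v] lies in the common hyperplane, so it is orthogonal
    to [w] as well, hence to itself. *)
Lemma same_hyperplane_colinear v w :
  [set x | dot v x = 0] = [set x | dot w x = 0] -> exists a, w = a *: v.
Proof.
move=> vw; set a := dot w v / dot v v; exists a.
set w' := w - a *: v.
have vw' : dot v w' = 0.
  rewrite dotBr dotZr /a; have [v0|v0] := eqVneq (dot v v) 0.
    have /eqP -> : v == 0 by rewrite -dotvv_eq0 v0.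
    by rewrite !dot0l mulr0 subr0.
  by rewrite divfK // dotC subrr.
have ww' : dot w w' = 0.
  by have : [set x | dot v x = 0] w' by []; rewrite vw.
apply/eqP; rewrite -subr_eq0 -/w' -dotvv_eq0 {1}/w'.
by rewrite dotC dotBr dotZr dotC ww' (dotC w') vw' mulr0 subr0.
Qed.

Lemma dot_continuous u : continuous (dot u).
Proof.
apply: (@continuous_big _ _ +%R) => [|i _ x]; first exact: add_continuous.
apply: (@cvgMl_tmp _ _ (nbhs x) _ (fun y => y ord0 i)).
exact: coord_continuous.
Qed.

Lemma nbhs_ray (A : set 'rV[R]_d) x v :
  nbhs x A -> exists2 e : R, 0 < e & A (x + e *: v).
Proof.
move=> xA; have : (fun e : R => x + e *: v) @ 0^'+ --> x.
  rewrite -[X in _ --> X]addr0 -(scale0r v); apply: cvgD; first exact: cvg_cst.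
  apply: cvgZr_tmp; exact: cvg_within.
move=> /(_ _ xA) Ax.
near (0 : R)^'+ => e; exists e; first by near: e; exact: nbhs_right_gt.
by near: e.
Unshelve. all: by end_near. Qed.

End Dot.

Lemma count_ltn (T : eqType) (a b : pred T) (s : seq T) t :
  {in s, forall u, a u -> b u} -> t \in s -> ~~ a t -> b t ->
  (count a s < count b s)%N.
Proof.
move=> ab ts at' bt.
rewrite -(size_filter b) -(count_predC a) count_filter.
rewrite (eq_in_count (a2 := a)) => [|u us]; last first.
  by rewrite /=; apply: andb_idr; exact: ab.
rewrite -addn1 leq_add2l -has_count; apply/hasP; exists t => //.
by rewrite mem_filter bt.
Qed.

(** * The fan of a central hyperplane arrangement *)

Section Arrangement.
Context {R : realType} {d : nat} (vs : seq 'rV[R]_d).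
Context (vsN : forall v, v \in vs -> - v \in vs).
Implicit Types (u v w x y z : 'rV[R]_d).

(** The weak tests for [v] and [- v] together record the full sign of [dot v y]. *)
Definition sign_cell x : set 'rV[R]_d :=
  [set y | forall v, v \in vs -> (0 <= dot v y) = (0 <= dot v x)].

(* The cone of the weak sign conditions satisfied by [x]; since [vs] is      *)
(* symmetric, [dot v x <= 0] and [dot v x = 0] are among these conditions.   *)
Definition sign_cone x : set 'rV[R]_d :=
  [set y | forall v, v \in vs -> 0 <= dot v x -> 0 <= dot v y].

(* A zero normal does occur when [d = 0], where x(I) = x(I^c) is no          *)
(* condition.                                                                *)
Definition generic x := forall v, v \in vs -> v != 0 -> dot v x != 0.

Lemma sign_cell_sym x y : sign_cell x y -> sign_cell y x.
Proof. by move=> xy v /xy. Qed.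

Lemma sign_cone_refl x : sign_cone x x.
Proof. by []. Qed.

Lemma sign_cone_trans x y z : sign_cone x y -> sign_cone y z -> sign_cone x z.
Proof. by move=> xy yz v vvs /xy -/(_ vvs); exact: yz. Qed.

Lemma sign_cell_cone x y : sign_cell x y -> sign_cone y = sign_cone x.
Proof.
by move=> xy; apply/seteqP; split=> z yz v vvs; move: (yz v vvs); rewrite xy.
Qed.

(** The form [- v] would give [dot v y <= 0] if [dot v x < 0]; at a generic [y] this is strict. *)
Lemma sign_cone_cell x y : generic y -> sign_cone x y -> sign_cell x y.
Proof.
move=> gy xy v vvs; apply/idP/idP; last exact: xy.
have [->|v0] := eqVneq v 0; first by rewrite !dot0l lexx.
move=> vy0; rewrite leNgt; apply/negP => vx0.
have := xy _ (vsN vvs); rewrite !dotNl !oppr_ge0 (ltW vx0) => /(_ isT) vy.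
by have := gy _ vvs v0; rewrite eq_le vy vy0.
Qed.

Lemma sign_coneE x y v : v \in vs -> sign_cone x y -> dot v x = 0 ->
  dot v y = 0.
Proof.
move=> vvs xy vx; apply/eqP; rewrite eq_le [X in _ && X]xy ?vx// andbT.
by rewrite -oppr_ge0 -dotNl xy ?vsN// dotNl vx oppr0.
Qed.

Lemma sign_coneD x y z : sign_cone x y -> sign_cone x z -> sign_cone x (y + z).
Proof. by move=> xy xz v vvs vx; rewrite dotDr addr_ge0 ?xy ?xz. Qed.

Lemma closed_sign_cone x : closed (sign_cone x).
Proof.
have -> : sign_cone x =
    \bigcap_(v in [set v | v \in vs /\ 0 <= dot v x])
      (dot v @^-1` [set t | 0 <= t]).
  by apply/seteqP; split=> y xy v => [[vvs vx]|vvs vx]; apply: xy.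
apply: closed_bigI => v _; apply: preimage_closed; last exact: closed_ge.
by move=> y _; exact: dot_continuous.
Qed.

Lemma closure_sign_cell x : closure (sign_cell x) = sign_cone x.
Proof.
apply/seteqP; split.
  have /closure_id -> := closed_sign_cone (x := x).
  by apply: closureS => y xy v vvs; rewrite xy.
(* Adding a small positive multiple of [x] gives the right strict sign to the forms vanishing at [y]
   but not at [x]. *)
move=> y xy A yA; have [e e0 Aye] := nbhs_ray x yA.
exists (y + e *: x); split=> // v vvs; rewrite dotDr dotZr.
have [vx|vx] := leP 0 (dot v x); first by rewrite addr_ge0 ?mulr_ge0 ?xy// ltW.
apply/negbTE; rewrite -ltNge -oppr_gt0 opprD -mulrN ltr_wpDl//.
  by rewrite -dotNl xy ?vsN// dotNl oppr_ge0 ltW.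
by rewrite mulr_gt0 ?oppr_gt0.
Qed.

Lemma near_dot_gt0 x :
  \forall y \near x, forall v, v \in vs -> 0 < dot v x -> 0 < dot v y.
Proof.
have FF : Filter (nbhs x) := nbhs_filter x.
elim: vs => [|v s IHs]; first by apply: (@filterE _ (nbhs x)) => y v.
have near_v : \forall y \near x, 0 < dot v x -> 0 < dot v y.
  have [vx|vx] := boolP (0 < dot v x); last first.
    by apply: (@filterE _ (nbhs x)).
  have := @cvgr_gt _ _ (nbhs x) FF _ _ (@dot_continuous _ _ v x) _ vx.
  by apply: (@filterS _ (nbhs x)) => y vy _.
apply: (@filterS2 _ (nbhs x)) near_v IHs => y vy sy w.
by rewrite inE => /predU1P[->|/sy].
Qed.

Lemma near_sign_cell x : generic x -> \forall y \near x, sign_cell x y.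
Proof.
move=> gx; apply: (@filterS _ (nbhs x)) (near_dot_gt0 x) => y xy v vvs.
have [->|v0] := eqVneq v 0; first by rewrite !dot0l.
have [vx|vx|vx] := ltgtP (dot v x) 0.
- apply/negbTE; rewrite -ltNge -oppr_gt0 -dotNl xy ?vsN//.
  by rewrite dotNl oppr_gt0.
- by rewrite ltW// xy.
- by have := gx _ vvs v0; rewrite vx eqxx.
Qed.

Lemma arrangement_cell_sign (H : set (set 'rV[R]_d)) x :
  H = [set [set z | dot v z = 0] | v in [set` vs]] ->
  arrangement_cell H x = sign_cell x.
Proof.
move=> ->; apply/seteqP; split=> y xy v.
  move=> vvs; have : Num.sg (dot v y) = Num.sg (dot v x) by apply: xy; exists v.
  by move=> vE; rewrite -sgr_ge0 vE sgr_ge0.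
move=> [w wvs /same_hyperplane_colinear [a ->]].
(* The sign of the scalar [a] factors out, and the tests for [w] and [- w] determine the sign. *)
rewrite !dotZl !sgrM; congr (_ * _).
have := xy _ (vsN wvs); rewrite !dotNl !oppr_ge0; have := xy _ wvs.
by case: (sgrP (dot w x)); case: (sgrP (dot w y)).
Qed.

Definition sign_fan : set (set 'rV[R]_d) := [set sign_cone x | x in setT].

Lemma finite_sign_fan : finite_set sign_fan.
Proof.
pose g (f : {ffun seq_sub vs -> bool}) : set 'rV[R]_d :=
  [set y | forall v : seq_sub vs, f v -> 0 <= dot (val v) y].
apply: (@sub_finite_set _ _ (range g)); last first.
  by apply: finite_image; exact: finite_finset.
move=> _ [x _ <-]; exists [ffun v => 0 <= dot (val v) x] => //.
apply/seteqP; split=> y xy v; last by rewrite ffunE; apply: xy; exact: valP.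
by move=> vvs vx; apply: (xy (SeqSub vvs)); rewrite ffunE.
Qed.

Lemma polyhedral_sign_cone x : polyhedral_cone (sign_cone x).
Proof.
exists [seq v <- vs | 0 <= dot v x]; apply/seteqP; split=> y xy v.
  by rewrite mem_filter => /andP[vx vvs]; exact: xy.
by move=> vvs vx; apply: xy; rewrite mem_filter vx.
Qed.

(** Forms positive at [z] survive a small step, and forms vanishing at [z] vanish at [y] too: [z] is
    relatively interior to [sign_cone z]. *)
Lemma sign_cone_opp x z y : sign_cone x z -> sign_cone z y ->
  exists2 e : R, 0 < e & sign_cone x (z - e *: y).
Proof.
move=> xz zy; have [e e0 near_e] := nbhs_ray (- y) (near_dot_gt0 z).
exists e => // v vvs vx; move: near_e => /(_ v vvs); rewrite -scalerN.
have := xz v vvs vx; rewrite le_eqVlt => /predU1P[vz0 _|vz /(_ vz)/ltW//].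
by rewrite dotDr dotZr dotNr (sign_coneE vvs zy) -?vz0// oppr0 mulr0 addr0.
Qed.

(* A point of the face on which as many forms as possible are positive lies  *)
(* in the relative interior of the face.                                     *)
Lemma sign_cone_face x F : cone_face (sign_cone x) F ->
  exists z, F = sign_cone z.
Proof.
move=> [u u_ge0 ->]; set F' := _ `&` _.
pose npos z := count (fun v => 0 < dot v z) vs.
pose P n := `[< exists2 z, F' z & npos z = n >].
have exP : exists n, P n.
  exists (npos 0); apply/asboolP; exists 0 => //.
  by split=> [v|] /=; rewrite dot0r.
have ubP n : P n -> (n <= size vs)%N.
  by move=> /asboolP[z _ <-]; exact: count_size.
have [n /asboolP[z [xz uz] nz] n_max] := ex_maxnP exP ubP.
exists z; apply/seteqP; split=> y => [[xy uy] v vvs vz|zy].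
  rewrite leNgt; apply/negP => vy.
  have vx : dot v x < 0.
    by rewrite ltNge; apply: contraL vy => /xy; rewrite -leNgt; exact.
  have vz0 : dot v z = 0.
    apply/eqP; rewrite eq_le vz andbT -oppr_ge0 -dotNl xz ?vsN//.
    by rewrite dotNl oppr_ge0 ltW.
  (* [z + y] stays in the face, keeps the positive forms of [z] and gains [- v], against
     maximality. *)
  have : (npos (z + y)%R <= n)%N.
    apply: n_max; apply/asboolP; exists (z + y) => //; split.
      exact: sign_coneD.
    by rewrite /= dotDr uz uy addr0.
  rewrite leqNgt -nz => /negP; apply; rewrite /npos.
  have sub w : w \in vs -> 0 < dot w z -> 0 < dot w (z + y).
    move=> wvs wz; rewrite dotDr ltr_pwDl// xy// leNgt.
    apply/negP => wx; have := xz _ (vsN wvs); rewrite !dotNl !oppr_ge0.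
    by rewrite (ltW wx) leNgt wz => /(_ isT).
  apply: (count_ltn sub (vsN vvs)).
    by rewrite /= dotNl vz0 oppr0 ltxx.
  by rewrite /= dotDr !dotNl vz0 oppr0 add0r oppr_gt0.
have xy : sign_cone x y := sign_cone_trans xz zy.
split=> //=; apply/eqP; rewrite eq_le u_ge0// andbT.
(* Since [u] vanishes at [z] and is nonnegative at [z - e *: y], it is nonpositive at [y]. *)
have [e e0 /u_ge0] := sign_cone_opp xz zy.
by rewrite dotBr uz sub0r dotZr oppr_ge0 pmulr_rle0.
Qed.

(** Each form in [s] is nonnegative on the first cone and nonpositive on the second, so their sum
    vanishes on the first cone only where all of them do. *)
Lemma sign_cone_meet x x' :
  cone_face (sign_cone x) (sign_cone x `&` sign_cone x').
Proof.
pose s := [seq v <- vs | (0 <= dot v x) && (dot v x' <= 0)].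
exists (\sum_(v <- s) v) => [y xy|].
  rewrite dot_suml big_seq sumr_ge0// => v.
  by rewrite mem_filter -andbA => /and3P[vx _ vvs]; exact: xy.
apply/seteqP; split=> y [xy] => [x'y|/= sy]; split=> //=.
  rewrite dot_suml big_seq big1// => v.
  rewrite mem_filter -andbA => /and3P[vx vx' vvs].
  apply/eqP; rewrite eq_le xy// andbT -oppr_ge0 -dotNl x'y ?vsN//.
  by rewrite dotNl oppr_ge0.
move=> v vvs vx'; have [vx|vx] := leP 0 (dot v x); first exact: xy.
have : - v \in s by rewrite mem_filter vsN// !dotNl oppr_ge0 oppr_le0 vx' ltW.
move=> vs'; move/eqP: sy.
rewrite dot_suml big_seq psumr_eq0 => [|w]; last first.
  by rewrite mem_filter -andbA => /and3P[wx _ wvs]; exact: xy.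
move=> /allP /(_ _ vs'); rewrite vs' dotNl oppr_eq0 => /eqP ->.
by rewrite lexx.
Qed.

Lemma sign_fan_polyhedral : polyhedral_fan sign_fan.
Proof.
split.
- exact: finite_sign_fan.
- by exists (sign_cone 0), 0.
- by move=> _ [x _ <-]; exact: polyhedral_sign_cone.
- by move=> _ F [x _ <-] /sign_cone_face[z ->]; exists z.
- move=> _ _ [x _ <-] [y _ <-]; split; first exact: sign_cone_meet.
  by rewrite setIC; exact: sign_cone_meet.
Qed.

Lemma generic_same_maximal_cone a b : generic a -> generic b ->
  (exists C, [/\ maximal_cone sign_fan C, interior C a & interior C b]) <->
  sign_cell a b.
Proof.
move=> ga gb; split.
  move=> [_ [[[x _ <-] _] /interior_subset xa /interior_subset xb]] v vvs.
  by rewrite (sign_cone_cell ga xa)// (sign_cone_cell gb xb).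
move=> ab; exists (sign_cone a).
have near_cone c : generic c -> interior (sign_cone c) c.
  move=> gc; apply: (@filterS _ (nbhs c)) (near_sign_cell gc) => y cy v vvs.
  by rewrite cy.
split; [split| |]; first by exists a.
- move=> _ [x _ <-] /(_ a (@sign_cone_refl a)) xa.
  by rewrite -(sign_cell_cone (sign_cone_cell ga xa)).
- exact: near_cone.
- by rewrite -(sign_cell_cone ab); exact: near_cone.
Qed.

End Arrangement.

(** * Orthants and the pieces of a bisector *)

Section CrossPolytopeBisectors.
Context {R : realType} {d : nat}.
Implicit Types (a b c x y v : 'rV[R]_d) (I J : {set 'I_d}) (i : 'I_d).

(** The normal of the facet F_I: its form is the l1-norm on the cone over F_I. *)
Definition sgn_vec I : 'rV[R]_d := \row_i (if i \in I then 1 else -1).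

Lemma dot_unit_vec i x : dot (unit_vec i) x = x ord0 i.
Proof.
rewrite /dot (bigD1 i)//= big1 => [|j ji]; rewrite mxE ?eqxx /=.
  by rewrite mul1r addr0.
by rewrite (negbTE ji) mul0r.
Qed.

Lemma dot_sgn_vec I x : dot (sgn_vec I) x = coord_sum x I - coord_sum x (~: I).
Proof.
rewrite /dot (bigID (mem I)) /= /coord_sum -sumrN; congr (_ + _).
  by apply: eq_bigr => i iI; rewrite mxE iI mul1r.
apply: eq_big => i; first by rewrite inE.
by move=> /negbTE iI; rewrite mxE iI mulN1r.
Qed.

Lemma sgn_vecC I : sgn_vec (~: I) = - sgn_vec I.
Proof.
by apply/rowP => i; rewrite !mxE inE; case: (i \in I); rewrite ?opprK.
Qed.

Lemma sgn_vec_sq I i : sgn_vec I ord0 i * sgn_vec I ord0 i = 1.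
Proof. by rewrite mxE; case: ifP; rewrite ?mulrNN mulr1. Qed.

Lemma normr_sgn_vec I i : `|sgn_vec I ord0 i| = 1.
Proof. by rewrite mxE; case: ifP; rewrite ?normrN1 ?normr1. Qed.

Lemma sgn_vec_norm I x i : 0 <= sgn_vec I ord0 i * x ord0 i ->
  `|x ord0 i| = sgn_vec I ord0 i * x ord0 i.
Proof. by move/ger0_norm <-; rewrite normrM normr_sgn_vec mul1r. Qed.

Lemma sgn_vec_le_norm I i (t : R) : sgn_vec I ord0 i * t <= `|t|.
Proof. by rewrite (le_trans (ler_norm _))// normrM normr_sgn_vec mul1r. Qed.

Definition orthant I : set 'rV[R]_d :=
  [set x | forall i, 0 <= sgn_vec I ord0 i * x ord0 i].

Lemma orthant_comb I n (l : 'I_n -> R) (p : 'I_n -> 'rV[R]_d) :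
  (forall k, 0 <= l k) -> (forall k, orthant I (p k)) ->
  orthant I (\sum_(k < n) l k *: p k).
Proof.
move=> l_ge0 Ip i; rewrite summxE mulr_sumr; apply: sumr_ge0 => k _.
by rewrite [X in _ * X]mxE mulrCA mulr_ge0// Ip.
Qed.

Lemma cross_facet_vertex I i : cross_facet I (sgn_vec I ord0 i *: unit_vec i).
Proof.
exists 1%N, (fun=> 1), (fun=> sgn_vec I ord0 i *: unit_vec i).
split=> // [|_|]; rewrite ?big_ord1 ?scale1r//.
rewrite mxE; case: ifPn => iI; first by left; exists i => //; rewrite scale1r.
by right; exists i; rewrite ?scaleN1r//= inE.
Qed.

Lemma conic_cross_facet I : conic_hull (cross_facet I) = orthant I.
Proof.
apply/seteqP; split=> x.
  move=> [n [l [p [l_ge0 Ip ->]]]]; apply: orthant_comb => // k.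
  have [m [l' [q [l'_ge0 _ Iq ->]]]] := Ip k; apply: orthant_comb => // j i.
  by have [] := Iq j; move=> [i' /=]; rewrite ?inE => i'I <-; rewrite !mxE;
    (have [<-|ii'] := eqVneq i' i;
     rewrite /= ?i'I ?(negbTE i'I) ?mulr1 ?mulrNN ?mulr1 ?oppr0 ?mulr0 ?ler01).
move=> Ix; exists d, (fun i => `|x ord0 i|).
exists (fun i => sgn_vec I ord0 i *: unit_vec i).
split=> [i|i|]; [exact: normr_ge0|exact: cross_facet_vertex|].
rewrite [LHS]row_sum_delta; apply: eq_bigr => i _.
by rewrite scalerA (sgn_vec_norm (Ix i)) mulrAC sgn_vec_sq mul1r.
Qed.

(* The coordinatewise bounds say that [c] and [sgn_vec I] have the same sign *)
(* wherever [I] and [J] differ.                                              *)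
Definition feasible I J c : Prop :=
  [/\ forall i, sgn_vec J ord0 i * c ord0 i <= sgn_vec I ord0 i * c ord0 i,
      dot (sgn_vec J) c <= 0 & 0 <= dot (sgn_vec I) c].

(* In the two cones, |x_i| - |x_i - c_i| ranges exactly over the interval    *)
(* from [sgn_vec J i * c_i] to [sgn_vec I i * c_i].                          *)
Lemma bis_facets_feasible I J c :
  bis_facets (cross_facet I) (cross_facet J) 0 c !=set0 <-> feasible I J c.
Proof.
rewrite /bis_facets !conic_cross_facet; split.
  move=> [x [[bisx [y Iy yx]] [z Jz zx]]].
  rewrite addr0 in yx; subst y.
  have xcE : z = x - c by rewrite -zx addrK.
  have lo i : sgn_vec J ord0 i * c ord0 i <= `|x ord0 i| - `|(x - c) ord0 i|.
    rewrite -xcE (sgn_vec_norm (Jz i)) xcE lerBrDr -mulrDr.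
    rewrite (_ : _ + _ = x ord0 i); first exact: sgn_vec_le_norm.
    rewrite !mxE. by rewrite addrCA subrr addr0.
  have hi i : `|x ord0 i| - `|(x - c) ord0 i| <= sgn_vec I ord0 i * c ord0 i.
    rewrite (sgn_vec_norm (Iy i)) lerBlDr -lerBlDl -mulrBr.
    rewrite (_ : _ - _ = (x - c) ord0 i); first exact: sgn_vec_le_norm.
    by rewrite !mxE.
  have sum0 : \sum_i (`|x ord0 i| - `|(x - c) ord0 i|) = 0.
    by move: bisx; rewrite /bis /= subr0 /l1norm sumrB => ->; rewrite subrr.
  split=> [i||]; first exact: le_trans (lo i) (hi i).
    by rewrite -sum0; apply: ler_sum => i _.
  by rewrite -sum0; apply: ler_sum => i _.
move=> [JI Jc Ic].
(* The same fraction [t] of every coordinate interval is used, chosen so that the total is zero. *)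
have [t [t0 t1 tE]] : exists t : R, [/\ 0 <= t, t <= 1 &
    t * dot (sgn_vec I) c + (1 - t) * dot (sgn_vec J) c = 0].
  set p := dot _ c in Ic *; set q := dot _ c in Jc *.
  (* If [p = q], both are zero and any [t] works. *)
  have [pq|pq] := eqVneq (p - q) 0.
    by exists 0; split; rewrite ?ler01//; lra.
  have pq0 : 0 < p - q by rewrite lt_neqAle eq_sym pq; lra.
  exists (- q / (p - q)); split.
  - by apply: divr_ge0; lra.
  - by rewrite ler_pdivrMr// mul1r; lra.
  - by field.
(* Where [I] and [J] agree the interval is a point, and any [x_i] beyond both 0 and [c_i] on the
   prescribed side attains it. *)
pose x : 'rV[R]_d := \row_i (
  if (i \in I) == (i \in J) then
    (if i \in I then Num.max 0 (c ord0 i) else Num.min 0 (c ord0 i))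
  else t * c ord0 i).
have xP i : [/\ 0 <= sgn_vec I ord0 i * x ord0 i,
    0 <= sgn_vec J ord0 i * (x - c) ord0 i
  & sgn_vec I ord0 i * x ord0 i - sgn_vec J ord0 i * (x - c) ord0 i =
    t * (sgn_vec I ord0 i * c ord0 i) +
    (1 - t) * (sgn_vec J ord0 i * c ord0 i)].
  have := JI i; rewrite !mxE.
  case: (i \in I); case: (i \in J) => /=.
  - by rewrite maxEle; case: ifPn; rewrite -?ltNge => ? _; split; nra.
  - by move=> ?; split; nra.
  - by move=> ?; split; nra.
  - by rewrite minEle; case: ifPn; rewrite -?ltNge => ? _; split; nra.
exists x; split; [split|].
- rewrite /bis /= subr0 /l1norm; apply/eqP; rewrite -subr_eq0 -sumrB.
  rewrite -[X in _ == X]tE /dot !mulr_sumr -big_split /=; apply/eqP; apply: eq_bigr => i _.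
  by have [Ix Jx <-] := xP i; rewrite (sgn_vec_norm Ix) (sgn_vec_norm Jx).
- by exists x; rewrite ?addr0// => i; have [] := xP i.
- by exists (x - c); rewrite ?subrK// => i; have [] := xP i.
Qed.

Lemma bis_equivE a b :
  bis_equiv 0 a 0 b <-> forall I J, feasible I J a <-> feasible I J b.
Proof.
split=> [ab I J|ab _ _ [I ->] [J ->]]; last by rewrite !bis_facets_feasible.
by rewrite -!bis_facets_feasible; apply: ab; [exists I|exists J].
Qed.

(** * Detecting signs by facet pairs *)

Definition nonneg_coords c : {set 'I_d} := [set i | 0 <= c ord0 i].

Lemma sgn_nonneg_coords c i :
  sgn_vec (nonneg_coords c) ord0 i * c ord0 i = `|c ord0 i|.
Proof.
by rewrite mxE inE; case: (ger0P (c ord0 i)); rewrite ?mul1r ?mulN1r.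
Qed.

(** For this [J] the lower ends are [- |c_i|], the least possible, so only the condition on [I]
    remains. *)
Lemma feasible_nonneg_coords I c :
  feasible I (~: nonneg_coords c) c <-> 0 <= dot (sgn_vec I) c.
Proof.
split=> [[]//|Ic]; rewrite /feasible sgn_vecC; split=> // [i|].
  rewrite mxE mulNr sgn_nonneg_coords lerNl -mulNr.
  have -> : - sgn_vec I ord0 i = sgn_vec (~: I) ord0 i.
    by rewrite sgn_vecC [RHS]mxE.
  exact: sgn_vec_le_norm.
rewrite dotNl oppr_le0; apply: sumr_ge0 => i _.
by rewrite sgn_nonneg_coords.
Qed.

Lemma feasible_orthant c : feasible (nonneg_coords c) (~: nonneg_coords c) c.
Proof.
apply/feasible_nonneg_coords; apply: sumr_ge0 => i _.
by rewrite sgn_nonneg_coords.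
Qed.

Lemma feasible_orthantP I c i : feasible I (~: I) c ->
  0 <= sgn_vec I ord0 i * c ord0 i.
Proof. by move=> [/(_ i)]; rewrite sgn_vecC mxE mulNr; lra. Qed.

Lemma general_position_perturb c v : general_position c ->
  exists2 e : R, 0 < e & bis_equiv 0 c 0 (c - e *: v).
Proof.
by move=> /(nbhs_ray (- v))[e e0 ce]; exists e; rewrite // -scalerN.
Qed.

(** If [c_i = 0], lowering it makes the feasible pair of [feasible_orthant] infeasible. *)
Lemma general_position_coord_neq0 c i : general_position c -> c ord0 i != 0.
Proof.
move=> /(general_position_perturb (unit_vec i))[e e0 /bis_equivE ce].
apply/eqP => ci0.
have /ce/(feasible_orthantP i) := feasible_orthant c.
by rewrite !mxE inE ci0 !eqxx lexx /=; lra.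
Qed.

Lemma general_position_sgn_neq0 c I :
  general_position c -> sgn_vec I != 0 -> dot (sgn_vec I) c != 0.
Proof.
move=> /(general_position_perturb (sgn_vec I))[e e0 /bis_equivE ce].
apply: contra => /eqP Ic0.
have /feasible_nonneg_coords/ce[_ _] : 0 <= dot (sgn_vec I) c by rewrite Ic0.
rewrite dotBr dotZr Ic0 sub0r oppr_ge0 pmulr_rle0// => II.
by rewrite -dotvv_eq0 eq_le II dotvv_ge0.
Qed.

(** * Sign vectors for the cross arrangement *)

(** Only the unit vectors need explicit negatives: complementing the set negates [sgn_vec]. *)
Definition cross_normals : seq 'rV[R]_d :=
  [seq unit_vec i | i : 'I_d] ++ [seq - unit_vec i | i : 'I_d] ++
  [seq sgn_vec A | A : {set 'I_d}].

Lemma cross_normalsP v : v \in cross_normals ->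
  [\/ exists i, v = unit_vec i, exists i, v = - unit_vec i
    | exists I, v = sgn_vec I].
Proof.
rewrite !mem_cat => /or3P[] /codomP[t ->].
- by constructor 1; exists t.
- by constructor 2; exists t.
- by constructor 3; exists t.
Qed.

Lemma unit_vec_normal i : unit_vec i \in cross_normals.
Proof. by rewrite mem_cat codom_f. Qed.

Lemma opp_unit_vec_normal i : - unit_vec i \in cross_normals.
Proof. by rewrite !mem_cat (codom_f (fun i => - unit_vec i)) orbT. Qed.

Lemma sgn_vec_normal I : sgn_vec I \in cross_normals.
Proof. by rewrite !mem_cat (codom_f sgn_vec) !orbT. Qed.

Lemma cross_normalsN v : v \in cross_normals -> - v \in cross_normals.
Proof.
case/cross_normalsP => -[t ->].
- exact: opp_unit_vec_normal.
- by rewrite opprK unit_vec_normal.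
- by rewrite -sgn_vecC sgn_vec_normal.
Qed.

Lemma cross_arrangementE :
  cross_arrangement R d =
  [set [set z | dot v z = 0] | v in [set` cross_normals]].
Proof.
have unitE i :
    [set x : 'rV[R]_d | dot (unit_vec i) x = 0] = [set x | x ord0 i = 0].
  by apply/seteqP; split=> x; rewrite /= dot_unit_vec.
have sgnE I : [set x : 'rV[R]_d | dot (sgn_vec I) x = 0] =
    [set x | coord_sum x I = coord_sum x (~: I)].
  apply/seteqP; split=> x /=; rewrite dot_sgn_vec.
    by move/eqP; rewrite subr_eq0 => /eqP.
  by move=> ->; rewrite subrr.
apply/seteqP; split=> A.
  case=> -[t _ <-]; first by exists (unit_vec t); rewrite ?unitE//=
    unit_vec_normal.
  by exists (sgn_vec t); rewrite ?sgnE//= sgn_vec_normal.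
case=> v /cross_normalsP[] [t ->] <-.
- by left; exists t.
- left; exists t => //; rewrite -unitE; apply/seteqP; split=> x /=.
    by rewrite dotNl => ->; rewrite oppr0.
  by rewrite dotNl => /eqP; rewrite oppr_eq0 => /eqP.
- by right; exists t.
Qed.

Lemma general_position_generic c :
  general_position c -> generic cross_normals c.
Proof.
move=> gc v /cross_normalsP[] [t ->] v0.
- by rewrite dot_unit_vec general_position_coord_neq0.
- by rewrite dotNl oppr_eq0 dot_unit_vec general_position_coord_neq0.
- exact: general_position_sgn_neq0.
Qed.

Lemma sign_cell_feasible I J a b :
  sign_cell cross_normals a b -> feasible I J a -> feasible I J b.
Proof.
move=> ab [IJ Ja Ia]; split.
- move=> i; move: (IJ i) (ab _ (unit_vec_normal i)).
  move: (ab _ (opp_unit_vec_normal i)); rewrite !dotNl !dot_unit_vec !mxE.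
  rewrite !oppr_ge0 => aN + ap.
  case: (i \in I); case: (i \in J) => // ai.
    suff : 0 <= b ord0 i by lra.
    by rewrite ap; lra.
  suff : b ord0 i <= 0 by lra.
  by rewrite aN; lra.
- rewrite -oppr_ge0 -dotNl -sgn_vecC ab ?sgn_vec_normal//.
  by rewrite sgn_vecC dotNl oppr_ge0.
- by rewrite ab ?sgn_vec_normal.
Qed.

(** By genericity of [b], it suffices to transfer weak inequalities from [a] to [b], each read off
    from one feasible pair. *)
Lemma bis_equiv_sign_cell a b : general_position a -> general_position b ->
  bis_equiv 0 a 0 b <-> sign_cell cross_normals a b.
Proof.
move=> ga gb; rewrite bis_equivE; split=> [ab|ab I J]; last first.
  by split; apply: sign_cell_feasible => //; exact: sign_cell_sym.
apply: (sign_cone_cell cross_normalsN (general_position_generic gb)).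
have /ab bP := feasible_orthant a.
move=> v /cross_normalsP[] [t ->].
- rewrite !dot_unit_vec => at0; have := feasible_orthantP t bP.
  by rewrite mxE inE at0 mul1r.
- rewrite !dotNl !dot_unit_vec oppr_ge0 => at0; have := feasible_orthantP t bP.
  have -> : sgn_vec (nonneg_coords a) ord0 t = -1; last by rewrite mulN1r.
  rewrite mxE inE; case: leP => // at0'.
  by have := general_position_coord_neq0 t ga; rewrite eq_le at0 at0'.
- by move=> /feasible_nonneg_coords/ab[].
Qed.

End CrossPolytopeBisectors.

Theorem theorem6p2 (R : realType) (d : nat) :
  is_bisection_fan (arrangement_fan (cross_arrangement R d)).
Proof.
have -> : arrangement_fan (cross_arrangement R d) = sign_fan cross_normals.
  apply: eq_imagel => x _.
  rewrite (arrangement_cell_sign _ _ cross_arrangementE).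
    exact: closure_sign_cell cross_normalsN x.
  exact: cross_normalsN.
split; first exact: sign_fan_polyhedral cross_normalsN.
move=> a b ga gb; rewrite bis_equiv_sign_cell//.
rewrite generic_same_maximal_cone//; first exact: cross_normalsN.
all: exact: general_position_generic.
Qed.
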